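(* Let $n^\ell=n^r=n\ge2$ and let all agents on both sides have degree constraint $d=2$. Suppose agents on both sides have identical preferences, i.e. all left agents have the same valuation function and the same ranking, and all right agents have the same valuation function and the same ranking. Then a matching satisfying both SD-DEF1 and DMMS exists and can be computed in polynomial time.
   Context: Write $[n]=\{0,\ldots,n-1\}$. There are two disjoint groups of agents, $N^\ell=[n]$ (left) and $N^r=[n]$ (right). A (valid) matching is a binary $n\times n$ matrix $M$ in which every row sum and every column sum is at most $d$. Write $M^\ell_i=\{j\in N^r: M(i,j)=1\}$ and $M^r_j=\{i\in N^\ell: M(i,j)=1\}$. Each left agent $i$ has a valuation function $u^\ell_i:N^r\to\mathbb{R}_{\ge0}$ and each right agent $j$ a valuation function $u^r_j:N^\ell\to\mathbb{R}_{\ge0}$, extended additively to sets. Each left agent $i$ also has a linear order $\sigma^\ell_i$ over $N^r$ consistent with $u^\ell_i$ (agents with strictly larger value come earlier; ties broken arbitrarily), and each right agent $j$ a linear order $\sigma^r_j$ over $N^\ell$ consistent with $u^r_j$; $\sigma(p)$ denotes the agent in position $p$, position $0$ being the most preferred. Let $\mathcal{M}$ be the set of valid matchings. The maximin share values are $MMS^\ell_i=\max_{M\in\mathcal{M}}\min_{i'\in N^\ell}u^\ell_i(M^\ell_{i'})$ and $MMS^r_j=\max_{M\in\mathcal{M}}\min_{j'\in N^r}u^r_j(M^r_{j'})$. A matching $M$ is DMMS if $u^\ell_i(M^\ell_i)\ge MMS^\ell_i$ for every $i\in N^\ell$ and $u^r_j(M^r_j)\ge MMS^r_j$ for every $j\in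 N^r$. $M$ is SD-EF1 over $N^\ell$ if for all $i,i'\in N^\ell$ and all $t\in[n]$, $\sum_{p=0}^t M(i,\sigma^\ell_i(p))\ge \sum_{p=0}^t M(i',\sigma^\ell_i(p))-1$; it is SD-EF1 over $N^r$ if for all $j,j'\in N^r$ and all $t\in[n]$, $\sum_{p=0}^t M(\sigma^r_j(p),j)\ge \sum_{p=0}^t M(\sigma^r_j(p),j')-1$. $M$ is SD-DEF1 if it is SD-EF1 over both $N^\ell$ and $N^r$. *)

(* Defs.v *)
From HB Require Import structures.
From mathcomp Require Import all_boot all_order all_fingroup all_algebra.
From mathcomp Require Import reals.

Set Implicit Arguments.
Unset Strict Implicit.
Unset Printing Implicit Defensive.

Import Order.TTheory GRing.Theory Num.Theory.

Local Open Scope ring_scope.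

(* [value i j] is the value agent i of this side assigns to agent j of the
   other side; [rank i p] is the agent that i puts in position p, position 0
   being the most preferred one. *)
Record profile (R : realType) (n : nat) := Profile {
  value : 'I_n -> 'I_n -> R;
  rank : 'I_n -> 'S_n;
  value_ge0 : forall i j, 0 <= value i j;
  rank_consistent : forall i (p q : 'I_n),
    value i (rank i q) < value i (rank i p) -> (p < q)%N
}.

Record instance (R : realType) (n : nat) := Instance {
  left_side : profile R n;
  right_side : profile R n
}.

Definition identical_profile (R : realType) n (P : profile R n) : Prop :=
  (forall i i' j, value P i j = value P i' j) /\
  (forall i i', rank P i = rank P i').

Definition identical_preferences (R : realType) n (I : instance R n) : Prop :=
  identical_profile (left_side I) /\ identical_profile (right_side I).

Section Matchings.

Variables (R : realType) (n : nat).
Implicit Types (M : 'M[bool]_n) (I : instance R n).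

Definition valid_matching (d : nat) M : bool :=
  [forall i, (\sum_(j < n) M i j <= d)%N] &&
  [forall j, (\sum_(i < n) M i j <= d)%N].

Definition left_bundle M (i : 'I_n) : {set 'I_n} := [set j | M i j].
Definition right_bundle M (j : 'I_n) : {set 'I_n} := [set i | M i j].

Definition util (u : 'I_n -> R) (A : {set 'I_n}) : R := \sum_(j in A) u j.

(* The default of the minimum is the agent's own bundle, one of the terms; the
   default 0 of the maximum is attained by the empty matching, as valuations
   are nonnegative. Hence these are the exact extrema. *)
Definition left_MMS (d : nat) I (i : 'I_n) : R :=
  let u := value (left_side I) i in
  \big[Num.max/0]_(M : 'M[bool]_n | valid_matching d M)
    \big[Num.min/util u (left_bundle M i)]_(i' < n) util u (left_bundle M i').

Definition right_MMS (d : nat) I (j : 'I_n) : R :=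
  let u := value (right_side I) j in
  \big[Num.max/0]_(M : 'M[bool]_n | valid_matching d M)
    \big[Num.min/util u (right_bundle M j)]_(j' < n) util u (right_bundle M j').

Definition DMMS (d : nat) I M : Prop :=
  (forall i, left_MMS d I i <= util (value (left_side I) i) (left_bundle M i)) /\
  (forall j,
     right_MMS d I j <= util (value (right_side I) j) (right_bundle M j)).

Definition left_SD_EF1 I M : Prop :=
  forall i i' t : 'I_n,
    let s := rank (left_side I) i in
    (\sum_(p < n | p <= t) M i' (s p) <= (\sum_(p < n | p <= t) M i (s p)) + 1)%N.

Definition right_SD_EF1 I M : Prop :=
  forall j j' t : 'I_n,
    let s := rank (right_side I) j in
    (\sum_(p < n | p <= t) M (s p) j' <= (\sum_(p < n | p <= t) M (s p) j) + 1)%N.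

Definition SD_DEF1 I M : Prop := left_SD_EF1 I M /\ right_SD_EF1 I M.

End Matchings.

(* Polynomial time is measured on structured programs for a random access
   machine with uniform cost. Integers and valuations live in separate
   memories, and the only arithmetic is addition and subtraction. After t steps
   each stored integer or valuation is therefore a combination of inputs and
   program constants with integer coefficients of O(t) bits, so on rational
   valuations polynomially many steps amount to polynomial bit complexity. *)

Inductive side := Left | Right.

Inductive iexp :=
| IConst of nat
| ISize
| IRank of side & iexp & iexp
| ILoad of iexp
| IAdd of iexp & iexp
| ISub of iexp & iexp.

Inductive vexp :=
| VValue of side & iexp & iexp
| VLoad of iexp
| VAdd of vexp & vexp
| VSub of vexp & vexp.

Inductive bexp :=
| BLeI of iexp & iexp
| BLeV of vexp & vexp
| BNot of bexp.

(* [Output i j b] writes b at position (i, j) of the output matrix. *)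
Inductive cmd :=
| Skip
| IStore of iexp & iexp
| VStore of iexp & vexp
| Output of iexp & iexp & bool
| Seq of cmd & cmd
| If of bexp & cmd & cmd
| While of bexp & cmd.

Fixpoint icost (e : iexp) : nat :=
  match e with
  | IConst _ | ISize => 1
  | IRank _ e1 e2 | IAdd e1 e2 | ISub e1 e2 => (icost e1 + icost e2).+1
  | ILoad e1 => (icost e1).+1
  end.

Fixpoint vcost (v : vexp) : nat :=
  match v with
  | VValue _ e1 e2 => (icost e1 + icost e2).+1
  | VLoad e => (icost e).+1
  | VAdd v1 v2 | VSub v1 v2 => (vcost v1 + vcost v2).+1
  end.

Fixpoint bcost (b : bexp) : nat :=
  match b with
  | BLeI e1 e2 => (icost e1 + icost e2).+1
  | BLeV v1 v2 => (vcost v1 + vcost v2).+1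
  | BNot b1 => (bcost b1).+1
  end.

Section Semantics.

Variables (R : realType) (n : nat) (I : instance R n).

Record state := State {
  imem : nat -> nat;
  vmem : nat -> R;
  outp : nat -> nat -> bool
}.

Definition init_state : state :=
  State (fun _ => 0%N) (fun _ => 0) (fun _ _ => false).

Definition output_matrix (s : state) : 'M[bool]_n :=
  \matrix_(i < n, j < n) outp s i j.

Definition profile_of (sd : side) : profile R n :=
  match sd with Left => left_side I | Right => right_side I end.

(* Input reads outside the index range return 0. *)
Definition read_rank (sd : side) (i p : nat) : nat :=
  match insub i, insub p with
  | Some i', Some p' => rank (profile_of sd) i' p'
  | _, _ => 0%N
  end.

Definition read_value (sd : side) (i j : nat) : R :=
  match insub i, insub j with
  | Some i', Some j' => value (profile_of sd) i' j'
  | _, _ => 0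
  end.

Fixpoint ieval (s : state) (e : iexp) : nat :=
  match e with
  | IConst k => k
  | ISize => n
  | IRank sd e1 e2 => read_rank sd (ieval s e1) (ieval s e2)
  | ILoad e1 => imem s (ieval s e1)
  | IAdd e1 e2 => (ieval s e1 + ieval s e2)%N
  | ISub e1 e2 => (ieval s e1 - ieval s e2)%N
  end.

Fixpoint veval (s : state) (v : vexp) : R :=
  match v with
  | VValue sd e1 e2 => read_value sd (ieval s e1) (ieval s e2)
  | VLoad e => vmem s (ieval s e)
  | VAdd v1 v2 => veval s v1 + veval s v2
  | VSub v1 v2 => veval s v1 - veval s v2
  end.

Fixpoint beval (s : state) (b : bexp) : bool :=
  match b with
  | BLeI e1 e2 => (ieval s e1 <= ieval s e2)%N
  | BLeV v1 v2 => veval s v1 <= veval s v2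
  | BNot b1 => ~~ beval s b1
  end.

Definition istore (s : state) (a k : nat) : state :=
  State (fun x => if x == a then k else imem s x) (vmem s) (outp s).

Definition vstore (s : state) (a : nat) (r : R) : state :=
  State (imem s) (fun x => if x == a then r else vmem s x) (outp s).

Definition write_output (s : state) (i j : nat) (b : bool) : state :=
  State (imem s) (vmem s)
    (fun x y => if (x == i) && (y == j) then b else outp s x y).

(* [exec c s t s']: from s, program c halts after t steps in s'. *)
Inductive exec : cmd -> state -> nat -> state -> Prop :=
| exec_skip s : exec Skip s 1 s
| exec_istore s a e :
    exec (IStore a e) s (icost a + icost e).+1
      (istore s (ieval s a) (ieval s e))
| exec_vstore s a v :
    exec (VStore a v) s (icost a + vcost v).+1
      (vstore s (ieval s a) (veval s v))
| exec_output s e1 e2 b :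
    exec (Output e1 e2 b) s (icost e1 + icost e2).+1
      (write_output s (ieval s e1) (ieval s e2) b)
| exec_seq c1 c2 s1 s2 s3 t1 t2 :
    exec c1 s1 t1 s2 -> exec c2 s2 t2 s3 ->
    exec (Seq c1 c2) s1 (t1 + t2).+1 s3
| exec_if b c1 c2 s t s' :
    exec (if beval s b then c1 else c2) s t s' ->
    exec (If b c1 c2) s (bcost b + t).+1 s'
| exec_while_end b c s :
    ~~ beval s b -> exec (While b c) s (bcost b).+1 s
| exec_while_step b c s1 s2 s3 t1 t2 :
    beval s1 b -> exec c s1 t1 s2 -> exec (While b c) s2 t2 s3 ->
    exec (While b c) s1 (bcost b + t1 + t2).+1 s3.

End Semantics.

(* One program, the same for all sizes, solves every instance satisfying the
   promise, in time polynomial in n. *)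
Definition polytime_computable (R : realType)
    (promise : forall n, instance R n -> Prop)
    (solution : forall n, instance R n -> 'M[bool]_n -> Prop) : Prop :=
  exists (c : cmd) (a k : nat), forall (n : nat) (I : instance R n),
    promise n I ->
    exists (t : nat) (s : state R),
      [/\ exec I c (init_state R) t s,
          (t <= a * n ^ k + a)%N &
          solution n I (output_matrix n s)].

(* Main.v *)
(** Identify every agent with its position in the common ranking of the other
side. For n even, match position a to positions a and n - 1 - a. For n = 2m + 1
the two partners of m coincide; transposing the columns m and m + 1 of the
diagonal repairs this, and replaces the bundles of the rows m and m + 1 by
{m, m + 1} and {m - 1, m}. The matrix is symmetric, so both sides are treated
alike. Every bundle {x < y} satisfies 2x <= n - 1 <= 2y, which gives SD-EF1, and
either x + y < n, or y = x + 1 and 2x < n. In both cases a count of the two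
available copies of each agent shows that no valid matching gives every agent
more than the value of {x, y}, which is the maximin share guarantee. The matching
depends on the rankings only, so one loop over the positions writes it down. *)

Require Import Defs.
From HB Require Import structures.
From mathcomp Require Import all_boot all_order all_fingroup all_algebra.
From mathcomp Require Import reals zify lra.

Set Implicit Arguments.
Unset Strict Implicit.
Unset Printing Implicit Defensive.

Import Order.TTheory GRing.Theory Num.Theory.

Local Open Scope ring_scope.

(** * The central matrix and the shape of its rows *)

Definition partner (n a : nat) : nat :=
  (if n == a.*2.+1 then a.+1 else if a.*2 == n.+1 then a.-1 else a)%N.

Definition central (n a b : nat) : bool :=
  (a + b == n.-1)%N || (b == partner n a).

Lemma centralC n a b : central n a b = central n b a.
Proof.
by rewrite /central /partner; do !case: ifP => ?; lia.
Qed.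

(** The witnesses are [n.-1 - a] and [partner n a], in increasing order. *)
Lemma central_row n (a : 'I_n) : (2 <= n)%N -> exists x y : 'I_n,
  [/\ forall r : 'I_n, central n a r = (r == x) || (r == y), (x < y)%N,
      (x.*2 < n <= y.*2.+1)%N & (x + y < n)%N || (y == x.+1 :> nat)].
Proof.
move=> n_ge2; have ltan := ltn_ord a.
have lt_rev : (n.-1 - a < n)%N by lia.
have lt_par : (partner n a < n)%N by rewrite /partner; do !case: ifP => ?; lia.
have [ltrp|lerp] := ltnP (n.-1 - a) (partner n a).
  exists (Ordinal lt_rev), (Ordinal lt_par).
  split=> [r|//|/=|/=]; last 2 first.
  - by move: ltrp; rewrite /partner; do !case: ifP => ?; lia.
  - by move: ltrp; rewrite /partner; do !case: ifP => ?; lia.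
  have := ltn_ord r; rewrite -!val_eqE /= /central; lia.
exists (Ordinal lt_par), (Ordinal lt_rev).
split=> [r|/=|/=|/=]; last 3 first.
- by move: lerp; rewrite /partner; do !case: ifP => ?; lia.
- by move: lerp; rewrite /partner; do !case: ifP => ?; lia.
- by move: lerp; rewrite /partner; do !case: ifP => ?; lia.
have := ltn_ord r; rewrite -!val_eqE /= /central; lia.
Qed.

(** * Weighted counting bound on maximin shares *)

Lemma sum_lt_ord n (x : nat) : (\sum_(r < n) (r < x) <= x)%N.
Proof.
elim: n => [|n IHn]; first by rewrite big_ord0.
rewrite big_ord_recr /=; case: (ltnP n x) => [ltnx|_]; last by rewrite addn0.
rewrite addn1; apply: leq_ltn_trans ltnx.
apply: (@leq_trans (\sum_(r < n) 1)%N); last first.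
  by rewrite big_const_ord iter_addn_0 mul1n.
by apply: leq_sum => r _; apply: leq_b1.
Qed.

(** Double counting: bundles all of weight at least [c] would together weigh at least [n * c], while
    each element lies in at most [d] of them. *)
Lemma light_bundle n d (F : 'I_n -> {set 'I_n}) (w : 'I_n -> nat) c :
  (forall r, \sum_i (r \in F i) <= d)%N -> (d * \sum_r w r < n * c)%N ->
  exists i, (\sum_(r in F i) w r < c)%N.
Proof.
move=> degF ltw; apply/existsP; apply: contraTT ltw => /existsPn heavy.
rewrite -leqNgt big_distrr /=.
apply: (@leq_trans (\sum_i \sum_(r in F i) w r)%N).
  rewrite -[X in (X * c)%N]card_ord -sum_nat_const.
  by apply: leq_sum => i _; rewrite leqNgt heavy.
under eq_bigr => i _ do rewrite big_mkcond /=.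
rewrite exchange_big /=; apply: leq_sum => r _.
apply: leq_trans (leq_mul (degF r) (leqnn _)); rewrite big_distrl /=.
by apply: leq_sum => i _; case: (r \in F i); rewrite ?mul1n.
Qed.

Section Ranked.

Variables (R : realType) (n : nat) (v : 'I_n -> R).
Hypothesis v_ge0 : forall r, 0 <= v r.
Hypothesis v_decr : forall p q : 'I_n, (p <= q)%N -> v q <= v p.

(** The earlier element is worth at most [v x] and the later at most [v y]; nonnegativity covers
    smaller bundles. *)
Lemma util_small (A : {set 'I_n}) (x y : 'I_n) : (#|A| <= 2)%N ->
  (forall r, r \in A -> (x <= r)%N) ->
  (forall r r', r != r' -> r \in A -> r' \in A -> (y <= maxn r r')%N) ->
  util v A <= v x + v y.
Proof.
move=> leA2 lexA leyA; rewrite /util; have [x0 y0] := (v_ge0 x, v_ge0 y).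
case: (posnP #|A|) => [/cards0_eq->|A_gt0]; first by rewrite big_set0 addr_ge0.
have [A1|A1] := eqVneq #|A| 1%N.
  case/eqP/cards1P: A1 => a defA; rewrite defA big_set1.
  have: v a <= v x by apply/v_decr/lexA; rewrite defA set11.
  by move: y0; lra.
have /cards2P[a [b [neq_ab defA]]] : #|A| == 2 by lia.
have [Aa Ab] : a \in A /\ b \in A by rewrite defA !inE !eqxx orbT.
have := leyA _ _ neq_ab Aa Ab; rewrite defA big_setU1 ?inE //= big_set1.
have [leab|ltba] := leqP a b => ley.
  by rewrite lerD ?v_decr ?lexA.
by rewrite addrC lerD ?v_decr ?lexA //.
Qed.

(* If x + y < n, give weight 2 to the positions < x and 1 to those in [x, y[; a
   bundle of weight at most 1 is worth at most v x + v y, and the total weight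
   2 (x + y) of the copies is less than 2 n. If y = x + 1, weight 1 on the
   positions < x suffices, with bundles of weight 0. *)
Lemma exists_small_bundle (F : 'I_n -> {set 'I_n}) (x y : 'I_n) :
  (forall i, #|F i| <= 2)%N -> (forall r, \sum_i (r \in F i) <= 2)%N ->
  (x < y)%N -> (x.*2 < n)%N -> (x + y < n)%N || (y == x.+1 :> nat) ->
  exists i, util v (F i) <= v x + v y.
Proof.
move=> F2 degF ltxy lt2x; case/orP => [ltxyn|/eqP defy].
  case: (@light_bundle _ 2 F (fun r => (r < x) + (r < y))%N 2 degF).
    rewrite [X in (_ < X)%N]mulnC ltn_mul2l /= big_split /=.
    exact: leq_ltn_trans (leq_add (sum_lt_ord n x) (sum_lt_ord n y)) ltxyn.
  move=> i light; exists i; apply: util_small => // [r Fr|r r' neq Fr Fr'].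
    rewrite leqNgt; apply/negP => ltrx; move: light.
    by rewrite (bigD1 r) //= ltrx (ltn_trans ltrx ltxy).
  rewrite leqNgt; apply/negP => ltmax; move: light.
  have [ltr ltr'] : (r < y)%N /\ (r' < y)%N by lia.
  rewrite (bigD1 r) //= (bigD1 r') /=; last by rewrite Fr' eq_sym.
  by rewrite ltr ltr' !addn1 addSn addnS.
case: (@light_bundle _ 2 F (fun r => (r < x) : nat)%N 1 degF).
  rewrite muln1; apply: leq_ltn_trans lt2x.
  by rewrite -mul2n leq_mul2l sum_lt_ord.
move=> i light; exists i.
have lexF r : r \in F i -> (x <= r)%N.
  move=> Fr; rewrite leqNgt; apply/negP => ltrx; move: light.
  by rewrite (bigD1 r) //= ltrx.
apply: util_small => // r r' neq Fr Fr'.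
(* Of two distinct positions from [x] on, the larger is at least [x.+1], which is [y]. *)
by move: (lexF r Fr) (lexF r' Fr') neq; rewrite -val_eqE /=; lia.
Qed.

End Ranked.

(** * Guarantees for the left side *)

Section OneSide.

Variables (R : realType) (n : nat) (I : instance R n).
Hypothesis n_ge2 : (2 <= n)%N.

Variables (rho s : 'S_n) (M : 'M[bool]_n).
Hypothesis ranks : forall i, rank (left_side I) i = s.
Hypothesis M_central : forall a b : 'I_n, M (rho a) (s b) = central n a b.

Lemma row_pairP (i : 'I_n) : exists x y : 'I_n,
  [/\ forall r : 'I_n, M i (s r) = (r == x) || (r == y), (x < y)%N,
      (x.*2 < n <= y.*2.+1)%N & (x + y < n)%N || (y == x.+1 :> nat)].
Proof.
have [x [y [row lt_xy mid sxy]]] := central_row (rho^-1 i)%g n_ge2.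
by exists x, y; split=> // r; rewrite -row -M_central permKV.
Qed.

(** A general [Q] serves both the degree bound and the prefix sums of SD-EF1. *)
Lemma row_sum (i : 'I_n) : exists x y : 'I_n,
  (x.*2 < n <= y.*2.+1)%N /\
  forall Q : pred 'I_n, (\sum_(p | Q p) M i (s p) = Q x + Q y)%N.
Proof.
have [x [y [row lt_xy mid _]]] := row_pairP i; exists x, y; split=> // Q.
have neq_yx : y != x by rewrite -val_eqE neq_ltn lt_xy orbT.
rewrite big_mkcond (bigD1 x) //= (bigD1 y) //= big1 => [|p /andP[npx npy]].
  by rewrite !row !eqxx orbT addn0; case: (Q x); case: (Q y).
by rewrite row (negPf npx) (negPf npy); case: (Q p).
Qed.

Lemma row_degree (i : 'I_n) : (\sum_(j < n) M i j <= 2)%N.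
Proof.
by have [x [y [_ row]]] := row_sum i; rewrite (reindex_inj (@perm_inj _ s)) /= row.
Qed.

Lemma left_SD_EF1_central : left_SD_EF1 I M.
Proof.
move=> i i' t /=; rewrite ranks.
have [x [y [mid ->]]] := row_sum i; have [x' [y' [mid' ->]]] := row_sum i'.
(* From [2x < n <= 2y' + 1] follows [x <= y']: once [i'] has both partners in the prefix, [i] has at
   least one. *)
have: (y' <= t)%N ==> (x <= t)%N by lia.
by do 4!case: (_ <= t)%N.
Qed.

Lemma left_MMS_central (i : 'I_n) :
  left_MMS 2 I i <= util (value (left_side I) i) (left_bundle M i).
Proof.
set u := value (left_side I) i; pose v r := u (s r).
have v_ge0 r : 0 <= v r by apply: value_ge0.
have v_decr (p q : 'I_n) : (p <= q)%N -> v q <= v p.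
  move=> lepq; rewrite leNgt; apply: contraL lepq => ltv; rewrite -ltnNge.
  by apply: (@rank_consistent _ _ (left_side I) i); rewrite ranks.
have utilE (A : {set 'I_n}) : util u A = util v (s @^-1: A).
  rewrite /util (reindex_inj (@perm_inj _ s)) /=.
  by apply: eq_bigl => r; rewrite inE.
have [x [y [row lt_xy mid sxy]]] := row_pairP i.
have -> : util u (left_bundle M i) = v x + v y.
  rewrite utilE /util (_ : _ @^-1: _ = [set x; y]).
    by rewrite big_setU1 ?big_set1 // inE -val_eqE neq_ltn lt_xy.
  by apply/setP => r; rewrite !inE row.
apply/bigmax_leP; split=> [|M' /andP[/forallP rowM' /forallP colM']].
  by rewrite addr_ge0.
(* A single bundle of [M'] worth at most [v x + v y] bounds the minimum; bundles are pulled back to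
   positions along [s]. *)
case: (exists_small_bundle v_ge0 v_decr (F := fun i' => s @^-1: left_bundle M' i')
  _ _ lt_xy _ sxy) => [i'|r||i' small].
- rewrite -sum1_card; apply: leq_trans (rowM' i').
  rewrite [X in (_ <= X)%N](reindex_inj (@perm_inj _ s)) /= big_mkcond.
  by apply: leq_sum => r _; rewrite !inE; case: (M' _ _).
- apply: leq_trans (colM' (s r)).
  by apply: leq_sum => i' _; rewrite !inE.
- by case/andP: mid.
by apply: le_trans (bigmin_le _ i' _) _; rewrite utilE.
Qed.

End OneSide.

(** * Exchange of the two sides *)

Definition mirror (R : realType) n (I : instance R n) : instance R n :=
  Instance (right_side I) (left_side I).

Lemma right_SD_EF1_mirror (R : realType) n (I : instance R n) (M : 'M[bool]_n) :
  left_SD_EF1 (mirror I) M^T -> right_SD_EF1 I M.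
Proof.
move=> EF1 j j' t /=; have := EF1 j j' t => /=.
under eq_bigr => p _ do rewrite mxE.
by under [X in (_ <= X + 1)%N]eq_bigr => p _ do rewrite mxE.
Qed.

Lemma right_bundle_tr n (M : 'M[bool]_n) j :
  right_bundle M j = left_bundle M^T j.
Proof. by apply/setP => i; rewrite !inE mxE. Qed.

Lemma valid_matching_tr n d (M : 'M[bool]_n) :
  valid_matching d M^T = valid_matching d M.
Proof.
rewrite /valid_matching andbC; congr (_ && _); apply: eq_forallb => i;
  by congr (_ <= _)%N; apply: eq_bigr => j _; rewrite mxE.
Qed.

(** Transposition preserves validity and turns right bundles into left ones, so every term of the
    right maximum occurs in the left one. *)
Lemma right_MMS_mirror (R : realType) n (I : instance R n) d j :
  right_MMS d I j <= left_MMS d (mirror I) j.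
Proof.
apply/bigmax_leP; split=> [|M validM]; first exact: bigmax_ge_id.
rewrite /left_MMS /= right_bundle_tr.
under eq_bigr => j' _ do rewrite right_bundle_tr.
by apply: (bigmax_sup M^T); rewrite ?valid_matching_tr.
Qed.

Section Central.

Variables (R : realType) (n : nat) (I : instance R n).
Hypothesis n_ge2 : (2 <= n)%N.
Variables sl sr : 'S_n.
Hypothesis left_rank : forall i, rank (left_side I) i = sl.
Hypothesis right_rank : forall j, rank (right_side I) j = sr.
Variable M : 'M[bool]_n.
Hypothesis M_central : forall a b : 'I_n, M (sr a) (sl b) = central n a b.

Lemma central_matchingP : [/\ valid_matching 2 M, SD_DEF1 I M & DMMS 2 I M].
Proof.
(* By symmetry of [central], [M^T] meets the hypothesis with the rankings exchanged. *)
have trM_central (a b : 'I_n) : M^T (sl a) (sr b) = central n a b.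
  by rewrite mxE M_central centralC.
split.
- apply/andP; split; apply/forallP => i; first exact: (row_degree n_ge2 M_central).
  have := row_degree n_ge2 trM_central i.
  by under eq_bigr do rewrite mxE.
- split; first exact: (left_SD_EF1_central n_ge2 left_rank M_central).
  by apply: right_SD_EF1_mirror;
    exact: (@left_SD_EF1_central _ _ (mirror I) n_ge2 sl sr).
split=> i; first exact: (left_MMS_central n_ge2 left_rank M_central i).
apply: le_trans (right_MMS_mirror I 2 i) _; rewrite right_bundle_tr.
exact: (@left_MMS_central _ _ (mirror I) n_ge2 sl sr).
Qed.

End Central.

(** * The program and its running time *)

(* For naturals, [1 - dist e e'] is the indicator of [e = e']. This computes
   [partner] without branching. *)
Definition partner_exp (a : iexp) : iexp :=
  let delta e := ISub (IConst 1) e in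
  let dist e e' := IAdd (ISub e e') (ISub e' e) in
  ISub (IAdd a (delta (dist (IAdd a a) (ISub ISize (IConst 1)))))
       (delta (dist (IAdd a a) (IAdd ISize (IConst 1)))).

(** Memory cell 0 holds the current row position. Rankings are common to a side, so those of agent 0
    are read; rows are left agents, hence ranked by the right side. *)
Definition mark_cell (b : iexp) : cmd :=
  Output (IRank Right (IConst 0) (ILoad (IConst 0))) (IRank Left (IConst 0) b) true.

Definition central_body : cmd :=
  Seq (Seq (mark_cell (ISub (ISub ISize (IConst 1)) (ILoad (IConst 0))))
           (mark_cell (partner_exp (ILoad (IConst 0)))))
      (IStore (IConst 0) (IAdd (ILoad (IConst 0)) (IConst 1))).

Definition central_prog : cmd :=
  While (BNot (BLeI ISize (ILoad (IConst 0)))) central_body.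

Section Program.

Variables (R : realType) (n : nat) (I : instance R n).
Hypothesis n_ge2 : (2 <= n)%N.
Variables sl sr : 'S_n.
Hypothesis left_rank : forall i, rank (left_side I) i = sl.
Hypothesis right_rank : forall j, rank (right_side I) j = sr.

Lemma ieval_partner (s : state R) e :
  (ieval I s e < n)%N -> ieval I s (partner_exp e) = partner n (ieval I s e).
Proof. by rewrite /= /partner; do !case: ifP => ?; lia. Qed.

Lemma read_rankE sd (ss : 'S_n) (p : 'I_n) :
  (forall i, rank (profile_of I sd) i = ss) -> read_rank I sd 0 p = ss p.
Proof.
move=> rankE; rewrite /read_rank insubT ?(ltnW n_ge2) // => n_gt0.
by rewrite valK rankE.
Qed.

Lemma mark_cell_exec (s : state R) b (p q : 'I_n) :
  imem s 0 = p -> ieval I s b = q ->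
  exec I (mark_cell b) s (7 + icost b) (write_output s (sr p) (sl q) true).
Proof.
move=> Ep Eq; have := exec_output I s (IRank Right (IConst 0) (ILoad (IConst 0)))
  (IRank Left (IConst 0) b) true.
by rewrite /= Ep Eq (@read_rankE Right sr) // (@read_rankE Left sl).
Qed.

(** The loop invariant, in ranked positions; as [sr] and [sl] are permutations, it fixes the whole
    output matrix. *)
Definition filled (k : nat) (s : state R) : Prop :=
  imem s 0 = k /\
  forall a b : 'I_n, outp s (sr a) (sl b) = (a < k)%N && central n a b.

(** The two marks cost 13 and 53, the increment 6, and the two sequencings 1 each: 74. *)
Lemma body_exec (s : state R) k : (k < n)%N -> filled k s ->
  exists2 s', exec I central_body s 74 s' & filled k.+1 s'.
Proof.
move=> ltkn [counter out]; pose p := Ordinal ltkn.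
have lt_par : (partner n k < n)%N by rewrite /partner; do !case: ifP => ?; lia.
have E1 : ieval I s (ISub (ISub ISize (IConst 1)) (ILoad (IConst 0))) = rev_ord p.
  by rewrite /= counter; lia.
pose s1 := write_output s (sr p) (sl (rev_ord p)) true.
have E2 : ieval I s1 (partner_exp (ILoad (IConst 0))) = Ordinal lt_par.
  by rewrite ieval_partner /= counter.
pose s2 := write_output s1 (sr p) (sl (Ordinal lt_par)) true.
have := exec_istore I s2 (IConst 0) (IAdd (ILoad (IConst 0)) (IConst 1)).
rewrite [ieval _ _ (IAdd _ _)]/= counter addn1 => E3; exists (istore s2 0 k.+1).
  exact: (exec_seq (exec_seq (mark_cell_exec (counter : imem s 0 = p) E1)
    (mark_cell_exec (counter : imem s1 0 = p) E2)) E3).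
split=> // a b; rewrite /= !val_eqE !(inj_eq perm_inj) out -!val_eqE /= /central.
(* Row [k] was blank, so its true cells are the two just marked; other rows are unchanged. *)
have := ltn_ord b; have [->|neq_ak] /= := eqVneq (a : nat) k.
  case: (b == partner n k :> nat) => /=; rewrite ltnSn ?orbT ?orbF //=.
  by case: eqP; lia.
by rewrite [in RHS]ltnS [in RHS]leq_eqVlt (negPf neq_ak).
Qed.

(** Each of the [j] remaining rounds costs 5 for the guard, 74 for the body and 1 for the loop; the
    final failing test costs 6. *)
Lemma prog_exec (s : state R) j k : (j + k)%N = n -> filled k s ->
  exists2 s', exec I central_prog s (80 * j + 6) s' & filled n s'.
Proof.
elim: j k s => [|j IHj] k s /=.
  rewrite add0n => -> filln; exists s => //.
  by apply: (@exec_while_end _ _ I (BNot (BLeI _ _))); rewrite /= filln.1 leqnn.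
move=> sumjk fillk; have ltkn : (k < n)%N by lia.
have [s1 exec1 fill1] := body_exec ltkn fillk.
have [|s2 exec2 fill2] := IHj _ _ _ fill1; first lia.
exists s2 => //; have guard : beval I s (BNot (BLeI ISize (ILoad (IConst 0)))).
  by rewrite /= fillk.1 -ltnNge.
have := exec_while_step guard exec1 exec2.
by rewrite (_ : 80 * j.+1 + 6 = (5 + 74 + (80 * j + 6)).+1)%N //; lia.
Qed.

End Program.

Theorem theorem8 (R : realType) :
  (forall (n : nat) (I : instance R n), (2 <= n)%N -> identical_preferences I ->
     exists M : 'M[bool]_n,
       [/\ valid_matching 2 M, SD_DEF1 I M & DMMS 2 I M]) /\
  polytime_computable
    (fun (n : nat) (I : instance R n) => (2 <= n)%N /\ identical_preferences I)
    (fun (n : nat) (I : instance R n) (M : 'M[bool]_n) =>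
       [/\ valid_matching 2 M, SD_DEF1 I M & DMMS 2 I M]).
Proof.
(* The output of a run also witnesses existence. *)
suff solve : polytime_computable
    (fun (n : nat) (I : instance R n) => (2 <= n)%N /\ identical_preferences I)
    (fun (n : nat) (I : instance R n) (M : 'M[bool]_n) =>
       [/\ valid_matching 2 M, SD_DEF1 I M & DMMS 2 I M]).
  split=> // n I n_ge2 idI; have [c [a [k run]]] := solve.
  by have [t [s [_ _ sol]]] := run n I (conj n_ge2 idI); exists (output_matrix n s).
exists central_prog, 80%N, 1%N => n I [n_ge2 [[_ eq_rankl] [_ eq_rankr]]].
pose i0 := Ordinal (ltnW n_ge2).
have left_rank i := eq_rankl i i0; have right_rank j := eq_rankr j i0.
case: (prog_exec n_ge2 left_rank right_rank (s := init_state R) (addn0 n)) => //.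
move=> s run [_ out]; exists (80 * n + 6)%N, s; split=> //.
  by rewrite expn1 leq_add2l.
apply: (central_matchingP n_ge2 left_rank right_rank) => a b.
by rewrite mxE out ltn_ord.
Qed.
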